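(* Let $l\in\{0,\tfrac12,1,\tfrac32,\ldots\}$ and let $m,n\in\{-l,-l+1,\ldots,l\}$ satisfy $m+n\ge 0$ and $m-n\ge 0$. Then for all $\theta\in[0,\pi/2]$ and $\phi,\psi\in[0,2\pi)$, $$t_{m,n}^l\begin{pmatrix} \sin\theta\,e^{i\phi}&-\cos\theta\,e^{-i\psi}\\ \cos\theta\,e^{i\psi}&\sin\theta\,e^{-i\phi}\end{pmatrix}=(-1)^{l-m}\left(\frac{(l+m)!\,(l-m)!}{(l+n)!\,(l-n)!}\right)^{1/2} e^{-i(m+n)\phi}\,e^{i(m-n)\psi}\,(\sin\theta)^{m+n}(\cos\theta)^{m-n}\,P_{l-m}^{(m+n,m-n)}(\cos 2\theta).$$
   Context: For $l\in\{0,\tfrac12,1,\tfrac32,\ldots\}$ let $\mathcal H_l$ be the complex vector space of homogeneous polynomials of degree $2l$ in two complex variables $z_1,z_2$, with basis $$\psi_n^l(z_1,z_2)=\binom{2l}{l-n}^{1/2} z_1^{l-n}z_2^{l+n}\qquad(n=-l,-l+1,\ldots,l).$$ The representation $t^l$ of $\mathrm{GL}(2,\mathbb C)$ on $\mathcal H_l$ is defined by $$\left(t^l\begin{pmatrix}a&b\\c&d\end{pmatrix}f\right)(z_1,z_2)=f(az_1+cz_2,\,bz_1+dz_2).$$ Its matrix elements $t^l_{m,n}$ ($m,n=-l,-l+1,\ldots,l$) are determined by $t^l(g)\psi_n^l=\sum_{m=-l}^l t_{m,n}^l(g)\,\psi_m^l$ for $g\in\mathrm{GL}(2,\mathbb C)$,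 where the sum runs over $m\in\{-l,-l+1,\ldots,l\}$. The Jacobi polynomials are $$P_n^{(\alpha,\beta)}(x)=\sum_{k=0}^n\frac{(n+\alpha+\beta+1)_k\,(\alpha+k+1)_{n-k}}{k!\,(n-k)!}\left(\frac{x-1}{2}\right)^k,$$ where $(a)_0=1$ and $(a)_k=a(a+1)\cdots(a+k-1)$ for $k\ge1$. The convention $0^0=1$ is used. *)

(* Defs.v *)
From HB Require Import structures.
From mathcomp Require Import all_boot all_order all_algebra.
From mathcomp Require Import complex mpoly reals trigo.

Set Implicit Arguments.
Unset Strict Implicit.
Unset Printing Implicit Defensive.

Import Order.TTheory GRing.Theory Num.Theory.
Local Open Scope ring_scope.
Local Open Scope complex_scope.

(* Spins and weights are rational numbers.  [Num.truncn] is used to read a   *)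
(* nonnegative integer of type [rat] (2l, l + n, l - n, ...) as a [nat].      *)
Definition half_integer (l : rat) : bool := 2 * l \is a Num.nat.

(* -l, -l + 1, ..., l *)
Definition weights (l : rat) : seq rat :=
  [seq k%:R - l | k <- iota 0 (Num.truncn (2 * l)).+1].

Definition weight (l : rat) : Type := seq_sub (weights l).
Definition weight_val (l : rat) (n : weight l) : rat := ssval n.
Coercion weight_val : weight >-> rat.

Section Homogeneous.

Variable R : realType.
Local Notation C := R[i].

Definition hpoly (l : rat) := dhomog 2 C (Num.truncn (2 * l)).

Definition z1 : {mpoly C[2]} := 'X_ord0.
Definition z2 : {mpoly C[2]} := 'X_ord_max.

Lemma z1_homog : z1 \is 1.-homog.
Proof. by rewrite dhomogX /= mdeg1. Qed.

Lemma z2_homog : z2 \is 1.-homog.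
Proof. by rewrite dhomogX /= mdeg1. Qed.

Definition psi_poly (l n : rat) : {mpoly C[2]} :=
  ((Num.sqrt ('C(Num.truncn (2 * l), Num.truncn (l - n))%:R : R))%:C : C)
    *: (z1 ^+ Num.truncn (l - n) * z2 ^+ Num.truncn (l + n)).

Lemma weightP (l : rat) (n : weight l) :
  exists2 k : nat, (k <= Num.truncn (2 * l))%N &
    [/\ (n : rat) = k%:R - l, Num.truncn (l + n) = k
      & Num.truncn (l - (n : rat)) = (Num.truncn (2 * l) - k)%N].
Proof.
case: n => x /= xP; rewrite /weight_val /=.
move/mapP: (xP) => [k]; rewrite mem_iota add0n ltnS /= => kl ->.
exists k => //; split=> //; first by rewrite addrC subrK natrK.
rewrite opprB addrA -mulr2n -[l *+ 2]mulr_natl.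
case: (lerP 0 (2 * l)) => [l0|l0].
  apply: truncn_def; have /andP[lo hi] := truncn_itv l0.
  rewrite -subSn // !natrB ?ltrD2r ?lerD2r ?lo ?hi //.
  exact: leq_trans kl _.
have t0 : Num.truncn (2 * l) = 0%N by rewrite truncn_floor leNgt l0.
by move: kl; rewrite t0 leqn0 => /eqP ->; rewrite subr0.
Qed.

Lemma psi_homog (l : rat) (n : weight l) :
  psi_poly l n \is (Num.truncn (2 * l)).-homog.
Proof.
rewrite /psi_poly; apply: dhomogZ.
have [k kl [_ -> ->]] := weightP n.
rewrite -{2}(subnK kl); apply: dhomogM.
  by rewrite -{2}[(_ - k)%N]mul1n; apply: dhomogMn z1_homog.
by rewrite -{2}[k]mul1n; apply: dhomogMn z2_homog.
Qed.

Definition psi (l : rat) (n : weight l) : hpoly l := DHomog (psi_homog n).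

(* f |-> f (a z1 + c z2, b z1 + d z2), for g = [a, b; c, d] *)
Definition mpoly_act (g : 'M[C]_2) (f : {mpoly C[2]}) : {mpoly C[2]} :=
  f \mPo [tuple g ord0 ord0 *: z1 + g ord_max ord0 *: z2;
                g ord0 ord_max *: z1 + g ord_max ord_max *: z2].

Lemma mpoly_act_homog (d : nat) (g : 'M[C]_2) (f : {mpoly C[2]}) :
  f \is d.-homog -> mpoly_act g f \is d.-homog.
Proof.
move=> /dhomogP fd; rewrite /mpoly_act comp_mpolyE big_seq.
apply: rpred_sum => m mf; apply: dhomogZ.
rewrite -(fd m mf) /= mdegE !big_ord_recl !big_ord0 mulr1 addn0.
apply: dhomogM.
  rewrite -{2}[m ord0]mul1n; apply: dhomogMn.
  by apply: dhomogD; apply: dhomogZ; rewrite (z1_homog, z2_homog).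
rewrite -{2}[m _]mul1n; apply: dhomogMn.
by apply: dhomogD; apply: dhomogZ; rewrite (z1_homog, z2_homog).
Qed.

(* The representation t^l of GL(2, C): the formula makes sense for every      *)
(* matrix g, and t^l is its restriction to [g \in unitmx].                    *)
Definition trep (l : rat) (g : 'M[C]_2) (f : hpoly l) : hpoly l :=
  DHomog (mpoly_act_homog g (valP f)).

Lemma trep_linear (l : rat) (g : 'M[C]_2) : linear (@trep l g).
Proof. by move=> a f h; apply: val_inj; rewrite /= /mpoly_act !linearP. Qed.

Lemma mpoly_act1 (f : {mpoly C[2]}) : mpoly_act 1%:M f = f.
Proof.
apply: etrans (comp_mpoly_id f); apply: (congr1 (fun s => comp_mpoly s f)).
apply: eq_from_tnth => i; rewrite tnth_mktuple (tnth_nth 0) !mxE /=.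
case: i => [[|[|//]] ilt] /=; rewrite !(scale0r, scale1r, addr0, add0r).
  by congr 'X_[U_(_)]; apply: val_inj.
by congr 'X_[U_(_)]; apply: val_inj.
Qed.

Lemma mpoly_actM (g h : 'M[C]_2) (f : {mpoly C[2]}) :
  mpoly_act (g *m h) f = mpoly_act g (mpoly_act h f).
Proof.
rewrite {3}/mpoly_act [f \mPo _]comp_mpolyE /mpoly_act raddf_sum /= comp_mpolyE.
apply: eq_bigr => m _; rewrite comp_mpolyZ rmorph_prod /=; congr (_ *: _).
apply: eq_bigr => i _; rewrite rmorphXn /=; congr (_ ^+ _).
rewrite !(tnth_nth 0).
case: i => [[|[|//]] ilt] /=;
  rewrite !mxE !big_ord_recl !big_ord0 !addr0 !comp_mpolyD !comp_mpolyZ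
    !comp_mpolyXU /= !scalerDl !scalerDr !scalerA ![_ * h _ _]mulrC
    addrACA (_ : lift ord0 ord0 = ord_max) //; exact: val_inj.
Qed.

Lemma trep1 (l : rat) (f : hpoly l) : trep 1%:M f = f.
Proof. by apply: val_inj; apply: mpoly_act1. Qed.

Lemma trepM (l : rat) (g h : 'M[C]_2) (f : hpoly l) :
  trep (g *m h) f = trep g (trep h f).
Proof. by apply: val_inj; apply: mpoly_actM. Qed.

Lemma size_weights (l : rat) : size (weights l) = (Num.truncn (2 * l)).+1.
Proof. by rewrite size_map size_iota. Qed.

Lemma card_weight (l : rat) : #|{: weight l}| = (Num.truncn (2 * l)).+1.
Proof.
rewrite card_seq_sub ?size_weights // map_inj_uniq ?iota_uniq //.
by move=> i j /addIr /eqP; rewrite eqr_nat => /eqP.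
Qed.

Lemma mcoeff_psi (l : rat) (m n : weight l) :
  (m == n) = ((psi_poly l m)@_(U_(ord0) *+ Num.truncn (l - (n : rat))
                       + U_(ord_max) *+ Num.truncn (l + n)) != 0).
Proof.
rewrite /psi_poly /z1 /z2 !mpolyXn -mpolyXD mcoeffZ mcoeffX.
rewrite mulf_eq0 negb_or.
have [i li [mE -> ->]] := weightP m; have [j lj [nE -> ->]] := weightP n.
have -> /= : ((Num.sqrt ('C(Num.truncn (2 * l), Num.truncn (2 * l) - i)%:R : R))%:C : C) != 0.
  by rewrite (inj_eq (@complexI R)) sqrtr_eq0 -ltNge ltr0n bin_gt0 leq_subr.
rewrite pnatr_eq0 eqb0 negbK; apply/eqP/eqP => [mn|/mnmP/(_ ord_max)].
  have ij : i = j.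
    by apply/eqP; rewrite -(eqr_nat rat) -(inj_eq (addIr (- l))) -mE -nE mn.
  by rewrite ij.
have F : (ord0 == ord_max :> 'I_2) = false by [].
rewrite !mnmDE !mulmnE !mnm1E F eqxx !mul0n !add0n !mul1n => ij.
by apply: val_inj; rewrite /= -[ssval m]/(m : rat) -[ssval n]/(n : rat) mE nE ij.
Qed.

Lemma psi_tnth (l : rat) (i : 'I_#|{: weight l}|) :
  (codom_tuple (@psi l))`_i = psi (enum_val i).
Proof. by rewrite nth_codom. Qed.

Lemma psi_basis (l : rat) : basis_of fullv (codom_tuple (@psi l)).
Proof.
have dimE : \dim {:hpoly l} = #|{: weight l}|.
  by rewrite card_weight dimvf /dim /= addn1 binSn.
rewrite basisEfree subvf dimE [size _]size_tuple leqnn !andbT.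
apply/freeP => c c0 i.
pose e : 'X_{1.. 2} := (U_(ord0) *+ Num.truncn (l - weight_val (enum_val i))
          + U_(ord_max) *+ Num.truncn (l + weight_val (enum_val i)))%MM.
have /(congr1 (fun p : hpoly l => (val p)@_e)) := c0.
rewrite !raddf_sum /= mcoeff0 (bigD1 i) //= big1 => [|j ji].
  rewrite addr0 psi_tnth mcoeffZ => /eqP; rewrite mulf_eq0 => /orP[/eqP //|].
  by rewrite -[_ == 0]negbK -mcoeff_psi eqxx.
rewrite psi_tnth mcoeffZ; apply/eqP; rewrite mulf_eq0 orbC.
by rewrite -[_ == 0]negbK -mcoeff_psi (inj_eq enum_val_inj) ji.
Qed.

(* The coordinates below are meaningful because [psi] is a basis of [hpoly l] *)
(* (lemma [psi_basis]); see [teltE] for their defining property.              *)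
Definition telt (l : rat) (m n : weight l) (g : 'M[C]_2) : C :=
  coord (codom_tuple (@psi l)) (enum_rank m) (trep g (psi n)).

Lemma teltE (l : rat) (n : weight l) (g : 'M[C]_2) :
  trep g (psi n) = \sum_(m : weight l) telt m n g *: psi m.
Proof.
rewrite {1}(coord_basis (psi_basis l) (memvf (trep g (psi n)))).
rewrite (reindex enum_rank) /=; last exact/onW_bij/enum_rank_bij.
by apply: eq_bigr => m _; rewrite psi_tnth enum_rankK.
Qed.

End Homogeneous.

Arguments psi {R l} n.
Arguments trep {R l} g f.
Arguments telt {R l} m n g.

Section Formula.

Variable R : realType.

(* e^{ix} *)
Definition expi (x : R) : R[i] := cos x +i* sin x.

Definition mx2 (T : Type) (a b c d : T) : 'M[T]_2 :=
  \matrix_(i < 2, j < 2)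
    if i == ord0 then (if j == ord0 then a else b)
    else (if j == ord0 then c else d).

Lemma mx2_unitmx (theta phi psi : R) :
  mx2 ((sin theta)%:C * expi phi) (- ((cos theta)%:C * expi (- psi)))
      ((cos theta)%:C * expi psi) ((sin theta)%:C * expi (- phi))
    \in unitmx.
Proof.
have eN x : expi x * expi (- x) = 1.
  rewrite /expi cosN sinN; simpc; rewrite -!expr2 cos2Dsin2.
  by rewrite mulrC addNr.
rewrite unitmxE unitfE (expand_det_row _ ord0) !big_ord_recl big_ord0 /cofactor !det_mx11 !mxE /=.
rewrite addn0 addn1 expr0 expr1 addr0 mul1r mulN1r mulrNN.
rewrite mulrACA eN mulrACA [expi (- psi) * _]mulrC eN !mulr1.
by rewrite -!rmorphM -rmorphD -!expr2 addrC cos2Dsin2 oner_neq0.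
Qed.

Definition pochhammer (a : R) (k : nat) : R := \prod_(i < k) (a + i%:R).

Definition jacobi (n : nat) (alpha beta x : R) : R :=
  \sum_(k < n.+1)
    pochhammer (n%:R + alpha + beta + 1) k
    * pochhammer (alpha + k%:R + 1) (n - k)
    / (k`! * (n - k)`!)%:R
    * ((x - 1) / 2) ^+ k.

End Formula.

(* Main.v *)
(* Extracting the coefficient of z1^(l-m) z2^(l+m) in
   (a z1 + c z2)^(l-n) (b z1 + d z2)^(l+n) writes t^l_{m,n} as a single sum.  On
   the given unitary matrix all phases factor out of that sum.  What remains is the
   expansion of the Jacobi polynomial in powers of (x-1)/2 and (x+1)/2, taken at
   x = cos 2theta, where these equal -sin^2 theta and cos^2 theta; it follows from
   the defining sum by (x+1)/2 = (x-1)/2 + 1 and the Vandermonde convolution. *)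
Require Import Defs.
From HB Require Import structures.
From mathcomp Require Import all_boot all_order all_algebra.
From mathcomp Require Import complex mpoly reals trigo.
From mathcomp Require Import zify ring.

Import Order.TTheory GRing.Theory Num.Theory.
Local Open Scope ring_scope.
Local Open Scope complex_scope.

Lemma pochhammer_nat (R : realType) (a k : nat) :
  pochhammer (a%:R + 1 : R) k = (('C(a + k, k) * k`!)%N)%:R.
Proof.
rewrite bin_ffact; elim: k => [|k IH]; first by rewrite /pochhammer big_ord0.
rewrite /pochhammer big_ord_recr /= -/(pochhammer _ k) IH addnS ffactnS /=.
by rewrite mulnC natrM -addSn natrD -natr1.
Qed.

(* Both sides equal (r + p)! / ((r - k)! (k - s)! (p + s)!). *)
Lemma bin_mul_bin (p r s k : nat) : (s <= k <= r)%N ->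
  ('C(r + p, r - s) * 'C(r - s, k - s) = 'C(r + p, r - k) * 'C(p + k, k - s))%N.
Proof.
case/andP=> sk kr.
apply/eqP; rewrite -(eqn_pmul2r (_ : 0 < (r - k)`! * (k - s)`! * (p + s)`!)%N); last first.
  by rewrite !muln_gt0 !fact_gt0.
have h1 := @bin_fact (r + p) (r - s) ltac:(lia).
have h2 := @bin_fact (r - s) (k - s) ltac:(lia).
have h3 := @bin_fact (r + p) (r - k) ltac:(lia).
have h4 := @bin_fact (p + k) (k - s) ltac:(lia).
rewrite (_ : r - s - (k - s) = r - k)%N in h2; last by lia.
rewrite (_ : r + p - (r - s) = p + s)%N in h1; last by lia.
rewrite (_ : r + p - (r - k) = p + k)%N in h3; last by lia.
rewrite (_ : p + k - (k - s) = p + s)%N in h4; last by lia.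
apply/eqP; transitivity ((r + p)`!).
  by rewrite -[RHS]h1 -h2; ring.
by rewrite -[LHS]h3 -h4; ring.
Qed.

(** With [y = (x - 1) / 2], both sides are polynomials in [y], and their coefficients of [y ^+ k]
    agree by the Vandermonde convolution. *)
Lemma jacobi_binomial (R : realType) (r p q : nat) (x : R) :
  jacobi r p%:R q%:R x =
  \sum_(s < r.+1) ('C(r + p, r - s) * 'C(r + q, s))%:R
     * ((x - 1) / 2) ^+ s * ((x + 1) / 2) ^+ (r - s).
Proof.
rewrite /jacobi; set y := (x - 1) / 2.
have -> : (x + 1) / 2 = y + 1 by rewrite /y; field.
(* This double sum links the two sides: summing over [s] first gives the defining sum, by
   Vandermonde; summing over [k] first gives the expansion of [(y + 1) ^+ (r - s)], by
   [bin_mul_bin]. *)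
transitivity (\sum_(s < r.+1) \sum_(k < r.+1 | (s <= k)%N)
   ('C(r + p, r - k) * ('C(p + k, k - s) * 'C(r + q, s)))%:R * y ^+ k).
  rewrite (exchange_big_dep predT) //=; apply: eq_bigr => k _.
  rewrite -mulr_suml -natr_sum -big_distrr /=; congr (_ * _).
  have kr : (k <= r)%N by rewrite -ltnS.
  have -> : (\sum_(s < r.+1 | (s <= k)%N) 'C(p + k, k - s) * 'C(r + q, s)
     = 'C(r + q + (p + k), k))%N.
    rewrite -binomial.Vandermonde.
    rewrite [RHS](big_ord_widen r.+1
      (fun s => 'C(r + q, s) * 'C(p + k, k - s)))%N ?ltnS //.
    by apply: eq_bigr => s _; rewrite mulnC.
  rewrite -!natrD !pochhammer_nat.
  rewrite (_ : r + p + q + k = r + q + (p + k))%N; last by lia.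
  rewrite (_ : p + k + (r - k) = r + p)%N; last by lia.
  rewrite !natrM; field.
  by rewrite !pnatr_eq0 -!lt0n !fact_gt0.
apply: eq_bigr => s _; rewrite exprD1n.
have sr : (s <= r)%N by rewrite -ltnS.
rewrite -(big_mkord (fun k => s <= k)%N (fun k =>
  ('C(r + p, r - k) * ('C(p + k, k - s) * 'C(r + q, s)))%:R * y ^+ k)).
(* The guard [s <= k] empties the range below [s]; the rest is reindexed by [k - s]. *)
rewrite (@big_cat_nat _ _ _ s) //=; last by lia.
rewrite big_nat_cond big1 ?add0r => [|k]; last by lia.
rewrite -{1}[s : nat]add0n big_addn big_mkord subSn // big_mkcond /= mulr_sumr.
apply: eq_bigr => k _; have kr : (k <= r - s)%N by rewrite -ltnS.
rewrite leq_addl addnK mulrnAr -mulrA -exprD [(s + k)%N]addnC -mulrnAl -mulrnA.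
congr (_%:R * _).
have := @bin_mul_bin p r s (k + s) ltac:(lia).
by rewrite addnK => h; rewrite mulnA -h; ring.
Qed.

Lemma mcoeff_z1z2 (R : realType) (e f j i : nat) :
  (z1 R ^+ e * z2 R ^+ f)@_(U_(ord0) *+ j + U_(ord_max) *+ i)
    = ((e == j) && (f == i))%:R.
Proof.
rewrite /z1 /z2 !mpolyXn -mpolyXD mcoeffX; congr (nat_of_bool _)%:R.
have F : (ord0 == ord_max :> 'I_2) = false by [].
have G : (ord_max == ord0 :> 'I_2) = false by [].
apply/eqP/andP => [/mnmP h|[/eqP -> /eqP ->] //].
move: (h ord0) (h ord_max); rewrite !mnmDE !mulmnE !mnm1E F G eqxx.
by rewrite !mul0n !mul1n !addn0 !add0n => -> ->; rewrite !eqxx.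
Qed.

(** Two binomial expansions; [u] and [v] are the powers of [z2] taken from the first and the second
    factor. *)
Lemma mcoeff_expD_mul (R : realType) (a b c d : R[i]) (P Q j i : nat) :
  ((a *: z1 R + c *: z2 R) ^+ P * (b *: z1 R + d *: z2 R) ^+ Q)
    @_(U_(ord0) *+ j + U_(ord_max) *+ i) =
  \sum_(u < P.+1) \sum_(v < Q.+1 | ((P - u + (Q - v) == j) && (u + v == i))%N)
    a ^+ (P - u) * c ^+ u * (b ^+ (Q - v) * d ^+ v) *+ ('C(P, u) * 'C(Q, v)).
Proof.
rewrite !exprDn mulr_suml raddf_sum /=; apply: eq_bigr => u _.
rewrite mulr_sumr raddf_sum /= [RHS]big_mkcond /=; apply: eq_bigr => v _.
set rhs := (if _ then _ else _); rewrite mulrnAl mulrnAr -mulrnA mcoeffMn !exprZn.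
rewrite -!(scalerAl, scalerAr) !scalerA.
rewrite [in X in _ *: X]mulrACA -!exprD mcoeffZ mcoeff_z1z2 {}/rhs.
case: ifP => _; last by rewrite mulr0 mul0rn.
by rewrite mulr1 mulnC; congr (_ *+ _); ring.
Qed.

(* With r = l-m, p = m+n, q = m-n one has l-n = r+q, l+n = r+p, l+m = r+p+q. *)
Lemma mcoeff_expD_mul_top (R : realType) (a b c d : R[i]) (r p q : nat) :
  ((a *: z1 R + c *: z2 R) ^+ (r + q) * (b *: z1 R + d *: z2 R) ^+ (r + p))
    @_(U_(ord0) *+ r + U_(ord_max) *+ (r + p + q)) =
  \sum_(s < r.+1)
    a ^+ (r - s) * c ^+ (q + s) * (b ^+ s * d ^+ (r + p - s))
      *+ ('C(r + q, r - s) * 'C(r + p, s)).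
Proof.
rewrite mcoeff_expD_mul.
rewrite -(big_mkord xpredT (fun u => \sum_(v < (r + p).+1 |
    ((r + q - u + (r + p - v) == r) && (u + v == r + p + q))%N)
   a ^+ (r + q - u) * c ^+ u * (b ^+ (r + p - v) * d ^+ v)
     *+ ('C(r + q, u) * 'C(r + p, v)))).
(* Since [v <= r + p], the condition [u + v = r + p + q] forces [u >= q]. For [u = s + q] it leaves
   the single value [v = r + p - s]. *)
rewrite (@big_cat_nat _ _ _ q) //=; last by lia.
rewrite [X in X + _]big_nat_cond big1 ?add0r => [|u]; last first.
  by move=> uq; rewrite big_pred0 // => v; have := ltn_ord v; lia.
rewrite -{1}[q]add0n big_addn big_mkord.
rewrite (_ : ((r + q).+1 - q = r.+1)%N); last by lia.
apply: eq_bigr => s _; have sr : (s <= r)%N by rewrite -ltnS.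
have vlt : (r + p - s < (r + p).+1)%N by lia.
rewrite (big_pred1 (Ordinal vlt)) /= => [|v]; last first.
  rewrite -[RHS]/(nat_of_ord v == r + p - s)%N; have := ltn_ord v; lia.
rewrite (_ : r + q - (s + q) = r - s)%N; last by lia.
rewrite (_ : r + p - (r + p - s) = s)%N; last by lia.
rewrite [(q + s)%N]addnC; congr (_ *+ (_ * _)).
  by rewrite -bin_sub; [congr 'C(_, _)|]; lia.
by rewrite bin_sub //; lia.
Qed.

(** Compares the coefficients of z1^(l-m) z2^(l+m) in [teltE]: among the basis vectors only [psi m]
    contains this monomial. Keeping its normalisation on the left avoids a division. *)
Lemma telt_mul_sqrt (R : realType) (l : rat) (m n : weight l) (g : 'M[R[i]]_2) :
  telt m n g * ((Num.sqrt 'C(Num.truncn (2 * l), Num.truncn (l - (m : rat)))%:R : R))%:C =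
  ((Num.sqrt 'C(Num.truncn (2 * l), Num.truncn (l - (n : rat)))%:R : R))%:C
  * ((g ord0 ord0 *: z1 R + g ord_max ord0 *: z2 R) ^+ Num.truncn (l - (n : rat))
     * (g ord0 ord_max *: z1 R + g ord_max ord_max *: z2 R) ^+ Num.truncn (l + (n : rat)))
    @_(U_(ord0) *+ Num.truncn (l - (m : rat)) + U_(ord_max) *+ Num.truncn (l + (m : rat))).
Proof.
set e := (_ + _)%MM; rewrite -mcoeffZ.
transitivity (val (trep g (psi n)))@_e.
  rewrite teltE raddf_sum raddf_sum /= (bigD1 m) //= big1 ?addr0 => [|k km].
    by rewrite !mcoeffZ mcoeff_z1z2 !eqxx mulr1.
  rewrite mcoeffZ; apply/eqP; rewrite mulf_eq0 orbC.
  by rewrite -[_ == 0]negbK -mcoeff_psi km.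
rewrite /= /mpoly_act /psi_poly comp_mpolyZ rmorphM !rmorphXn /=.
by rewrite /z1 /z2 !comp_mpolyXU.
Qed.

(** Used with [N] = 2l, [i] = l+m, [j] = l+n: the factorial square root of the theorem is the
    quotient of the normalisations of [psi n] and [psi m]. *)
Lemma sqrt_bin_ratio (R : realType) (N i j : nat) : (i <= N)%N -> (j <= N)%N ->
  Num.sqrt ('C(N, N - j)%:R : R) =
  Num.sqrt ((i`! * (N - i)`!)%:R / (j`! * (N - j)`!)%:R)
  * Num.sqrt 'C(N, N - i)%:R.
Proof.
move=> iN jN; rewrite -sqrtrM ?divr_ge0 ?ler0n // !bin_sub //; congr Num.sqrt.
have fj : (j`! * (N - j)`!)%:R != 0 :> R.
  by rewrite pnatr_eq0 -lt0n muln_gt0 !fact_gt0.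
apply: (mulIf fj); rewrite mulrAC divfK // -!natrM bin_fact //.
by rewrite mulnC bin_fact.
Qed.

Lemma expiD (R : realType) (x y : R) : expi (x + y) = expi x * expi y.
Proof. by rewrite /expi cosD sinD; simpc; congr (_ +i* _); rewrite addrC. Qed.

Lemma expi_natM (R : realType) (k : nat) (x : R) :
  expi (k%:R * x) = expi x ^+ k.
Proof.
elim: k => [|k IH]; first by rewrite mul0r /expi cos0 sin0.
by rewrite -natr1 mulrDl mul1r expiD IH exprSr.
Qed.

Lemma expi_mulN (R : realType) (x : R) : expi x * expi (- x) = 1.
Proof. by rewrite -expiD subrr /expi cos0 sin0. Qed.

(** Reversing the summation and moving the sign from the sine to the cosine, at the cost of
    [(-1) ^+ r], gives the form met in the matrix coefficient. *)
Lemma jacobi_cos2x (R : realType) (r p q : nat) (theta : R) :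
  jacobi r p%:R q%:R (cos (2 * theta)) =
  (-1) ^+ r * \sum_(s < r.+1) ('C(r + q, r - s) * 'C(r + p, s))%:R
    * ((- cos theta ^+ 2) ^+ s * (sin theta ^+ 2) ^+ (r - s)).
Proof.
rewrite jacobi_binomial (reindex_inj rev_ord_inj) mulr_sumr /=.
apply: eq_bigr => s _; have sr : (s <= r)%N by rewrite -ltnS.
rewrite subSS (subKn sr) mulnC -!mulrA [RHS]mulrCA; congr (_ * _).
have sin2 := sin2cos2 theta.
have -> : (cos (2 * theta) - 1) / 2 = - sin theta ^+ 2.
  by rewrite mulr_natl cos_mulr2n sin2; field.
have -> : (cos (2 * theta) + 1) / 2 = cos theta ^+ 2.
  by rewrite mulr_natl cos_mulr2n; field.
have -> : (-1) ^+ r = (-1) ^+ (r - s) * (-1) ^+ s :> R by rewrite -exprD subnK.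
(* The factor 1 becomes the square of [(-1) ^+ s], which balances the signs for [ring]. *)
rewrite ![(- (_ ^+ 2)) ^+ _]exprNn -[LHS]mulr1.
by rewrite -[X in _ * X = _](sqrr_sign R s); ring.
Qed.

(** Here [x], [x'] and [y], [y'] are pairs of inverse phases. They cancel in [(x * x') ^+ t] and
    [(y * y') ^+ s], so the surviving phase does not depend on [s] or [t]. *)
Lemma monomial_regroup (A : comNzRingType) (a b x x' y y' : A) (p q s t : nat) :
  x * x' = 1 -> y * y' = 1 ->
  (a * x) ^+ t * (b * y) ^+ (q + s) * ((- (b * y')) ^+ s * (a * x') ^+ (t + p)) =
  x' ^+ p * y ^+ q * a ^+ p * b ^+ q * ((- b ^+ 2) ^+ s * (a ^+ 2) ^+ t).
Proof.
move=> xx' yy'.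
transitivity (x' ^+ p * y ^+ q * a ^+ p * b ^+ q * ((- b ^+ 2) ^+ s * (a ^+ 2) ^+ t)
  * (x * x') ^+ t * (y * y') ^+ s); last by rewrite xx' yy' !expr1n !mulr1.
rewrite -[- (b * y')]mulN1r -[- b ^+ 2]mulN1r; move: (-1) => e.
rewrite !(expr2, exprMn, exprD); ring.
Qed.

Lemma unitary_summandE (R : realType) (r p q s : nat) (theta phi psi : R) : (s <= r)%N ->
  ((sin theta)%:C * expi phi) ^+ (r - s) * ((cos theta)%:C * expi psi) ^+ (q + s)
  * ((- ((cos theta)%:C * expi (- psi))) ^+ s
     * ((sin theta)%:C * expi (- phi)) ^+ (r + p - s)) =
  expi (- (p%:R * phi)) * expi (q%:R * psi)
  * (sin theta ^+ p)%:C * (cos theta ^+ q)%:C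
  * ((- cos theta ^+ 2) ^+ s * (sin theta ^+ 2) ^+ (r - s))%:C.
Proof.
move=> sr; rewrite -[- (_%:R * _)]mulrN !expi_natM -addnBAC //.
rewrite !rmorphM !rmorphXn rmorphN rmorphXn /=.
exact: monomial_regroup (expi_mulN R phi) (expi_mulN R psi).
Qed.

Theorem theorem4p2 (R : realType) (l : rat) (hl : half_integer l)
    (m n : weight l) (hadd : 0 <= (m : rat) + (n : rat))
    (hsub : 0 <= (m : rat) - (n : rat)) (theta phi psi : R)
    (htheta : 0 <= theta <= pi / 2) (hphi : 0 <= phi < 2 * pi)
    (hpsi : 0 <= psi < 2 * pi) :
  telt m n (mx2 ((sin theta)%:C * expi phi)
                (- ((cos theta)%:C * expi (- psi)))
                ((cos theta)%:C * expi psi)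
                ((sin theta)%:C * expi (- phi))) =
  (-1) ^+ Num.truncn (l - (m : rat))
  * (Num.sqrt (((Num.truncn (l + (m : rat)))`! * (Num.truncn (l - (m : rat)))`!)%:R
               / ((Num.truncn (l + (n : rat)))`! * (Num.truncn (l - (n : rat)))`!)%:R : R))%:C
  * expi (- (ratr ((m : rat) + (n : rat)) * phi))
  * expi (ratr ((m : rat) - (n : rat)) * psi)
  * (sin theta ^+ Num.truncn ((m : rat) + (n : rat)))%:C
  * (cos theta ^+ Num.truncn ((m : rat) - (n : rat)))%:C
  * (jacobi (Num.truncn (l - (m : rat))) (ratr ((m : rat) + (n : rat)))
       (ratr ((m : rat) - (n : rat))) (cos (2 * theta)))%:C.
Proof.
have [i iN [mE mi mNi]] := weightP m; have [j jN [nE nj nNj]] := weightP n.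
set N := Num.truncn (2 * l) in iN mNi jN nNj.
(* As 2l is a natural number, its truncation [N] is exact; all weights are now expressed by [i] =
   l+m and [j] = l+n. *)
have lE : l + l = N%:R by rewrite (truncnK hl) mulr_natl mulr2n.
have ji : (j <= i)%N by move: hsub; rewrite mE nE opprB addrA subrK subr_ge0 ler_nat.
have Nij : (N <= i + j)%N.
  by move: hadd; rewrite mE nE addrACA -opprD lE subr_ge0 -natrD ler_nat.
have sumE : (m : rat) + (n : rat) = (i + j - N)%:R.
  by rewrite mE nE addrACA -opprD lE natrB // natrD.
have diffE : (m : rat) - (n : rat) = (i - j)%:R by rewrite mE nE opprB addrA subrK natrB.
have sqrt_neq0 : ((Num.sqrt 'C(N, N - i)%:R : R))%:C != 0.
  by rewrite (inj_eq (@complexI R)) sqrtr_eq0 -ltNge ltr0n bin_gt0 leq_subr.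
apply: (mulIf sqrt_neq0); rewrite -{1}mNi telt_mul_sqrt.
rewrite !mxE /= sumE diffE !ratr_nat !natrK mi mNi nj nNj -/N.
rewrite (@sqrt_bin_ratio R _ _ _ iN jN) rmorphM /=.
set r := (N - i)%N; set p := (i + j - N)%N; set q := (i - j)%N.
(* In terms of [r] = l-m, [p] = m+n and [q] = m-n no truncated subtraction is left in these
   exponents. *)
have [-> -> ->] : [/\ (N - j = r + q)%N, j = (r + p)%N & i = (r + p + q)%N].
  by rewrite /r /p /q; clear -iN jN ji Nij; clearbody N; split; lia.
have jacE : (jacobi r p%:R q%:R (cos (2 * theta)))%:C =
    (-1) ^+ r * \sum_(s < r.+1) ('C(r + q, r - s) * 'C(r + p, s))%:R
      * ((- cos theta ^+ 2) ^+ s * (sin theta ^+ 2) ^+ (r - s))%:C.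
  rewrite jacobi_cos2x rmorphM rmorph_sign rmorph_sum; congr (_ * _).
  by apply: eq_bigr => s _; rewrite rmorphM rmorph_nat.
have sr (s : 'I_r.+1) : (s <= r)%N by rewrite -ltnS.
rewrite mcoeff_expD_mul_top {}jacE.
(* The phases and the powers with exponents [p] and [q] are common to all summands; what remains is
   the sum in [jacE]. *)
under eq_bigr => s _ do rewrite unitary_summandE // -mulr_natl mulrCA.
rewrite -mulr_sumr; set S := \sum_(s < r.+1) _.
move: (Num.sqrt (_ / _))%:C (Num.sqrt 'C(N, r)%:R)%:C (sin theta ^+ p)%:C
  (cos theta ^+ q)%:C (expi _) (expi _) @S ((-1) ^+ r) (sqrr_sign R[i] r).
move=> a b c d e f S sg sgK.
(* The right side carries [(-1) ^+ r] twice, from the prefactor and from the Jacobi polynomial;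
   [sgK] supplies the matching square on the left. *)
by rewrite -[LHS]mulr1 -[X in _ * X = _]sgK; clear; ring.
Qed.
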